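(* Consider the following conditions. (Moment) There exists a constant $\eta\in(0,1)$ such that $\mathbb{E}[N(g_1)^\eta]<+\infty$. (Column comparability) For any $1\leq j\leq d$, there exists a constant $C>1$ such that for any $g=(g^{i,j})_{1\leq i,j\leq d}\in\operatorname{supp}\mu$, $1\leq\frac{\max_{1\leq i\leq d}g^{i,j}}{\min_{1\leq i\leq d}g^{i,j}}\leq C$. (Harmonic moments) For any $1\leq i,j\leq d$, there exists a constant $\delta>0$ such that $\mathbb{E}[(g_1^{i,j})^{-\delta}]<\infty$. (Non-arithmeticity) For $t>0$, $\theta\in[0,2\pi)$ and a function $\varphi:\mathbb{S}_+^{d-1}\to\mathbb{R}$, the equation $$|gx|^{it}\varphi(g\cdot x)=e^{i\theta}\varphi(x),\quad \forall g\in\Gamma_\mu,\ \forall x\in\operatorname{supp}\nu,$$ has no trivial solution except that $t=0$, $\theta=0$ and $\varphi$ is a constant. Assume either condition (Column comparability), or conditions (Moment), (Harmonic moments) and (Non-arithmeticity). Then, for any $s\in\{0\}\cup I_\mu^\circ$, there exists a constant $\alpha>0$ such that $$\sup_{f\in\mathbb{S}_+^{d-1}}\int_{\mathbb{S}_+^{d-1}}\frac{1}{|\langle f,x\rangle|^\alpha}\,\nu_s(dx)<+\infty .$$ In particular, for any $s\in\{0\}\cup I_\mu^\circ$, there exist constants $\alpha,C>0$ such that for any $0<t<1$, $$\sup_{f\in\mathbb{S}_+^{d-1}}\nu_s\left(\left\{x\in\mathbb{S}_+^{d-1}:|\langle f,x\rangle|\leq t\right\}\right)\leq Ct^\alpha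 .$$ Moreover, both assertions remain valid when the eigenmeasure $\nu_s$ is replaced by the stationary measure $\pi_s$.
   Context: Fix an integer $d\geq 2$. $\mathcal{M}_+$ is the multiplicative semigroup of $d\times d$ matrices with non-negative real entries. A matrix $g\in\mathcal{M}_+$ is allowable if every row and every column of $g$ contains a strictly positive entry; $g^{i,j}$ is the $(i,j)$-th entry of $g$. $\mathbb{R}^d$ carries the standard scalar product $\langle\cdot,\cdot\rangle$ and Euclidean norm $|\cdot|$; $x\geq 0$ means that all components of $x$ are non-negative. $\mathbb{S}_+^{d-1}=\{x\geq 0:|x|=1\}$, and $\mathcal{C}(\mathbb{S}_+^{d-1})$ is the space of continuous complex-valued functions on it. $(g_n)_{n\geq1}$ is a sequence of i.i.d. positive random matrices with law $\mu$ on $\mathcal{M}_+$, and $G_n=g_n\cdots g_1$. For $g\in\mathcal{M}_+$, $\|g\|=\sup_{x\in\mathbb{S}_+^{d-1}}|gx|$, $\iota(g)=\inf_{x\in\mathbb{S}_+^{d-1}}|gx|$, $N(g)=\max\{\|g\|,\iota(g)^{-1}\}$. $\operatorname{supp}\mu$ is the support of $\mu$ and $\Gamma_\mu$ is the smallest closed subsemigroup of $\mathcal{M}_+$ generated by $\operatorname{supp}\mu$. For $x\in\mathbb{S}_+^{d-1}$ and $g$ allowable, $g\cdot x=gx/|gx|$; $X_0^x=x$ and $X_n^x=G_n\cdot x$ for $n\geq1$. $(X_n^x)_{n\geq 0}$ is a Markov chain on $\mathbb{S}_+^{d-1}$, and $\nu$ denotes its unique stationary probability measure, i.e. $\int\int\varphi(g\cdot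 x)\,\mu(dg)\,\nu(dx)=\int\varphi\,d\nu$ for all $\varphi\in\mathcal{C}(\mathbb{S}_+^{d-1})$ (existence and uniqueness are known under (Moment) together with the condition that every $g\in\Gamma_\mu$ is allowable and $\Gamma_\mu$ contains a matrix with all entries strictly positive). $I_\mu=\{s\geq0:\mathbb{E}(\|g_1\|^s)<\infty\}$, an interval, with interior $I_\mu^\circ$. For $s\in I_\mu$ the transfer operator is $P_s\varphi(x)=\int_{\Gamma_\mu}|gx|^s\varphi(g\cdot x)\,\mu(dg)$, $x\in\mathbb{S}_+^{d-1}$. It is known that $P_s$ has a dominating eigenvalue $\kappa(s)$, a unique (up to scaling) continuous strictly positive eigenfunction $r_s$ on $\mathbb{S}_+^{d-1}$ and a unique probability eigenmeasure $\nu_s$ on $\mathbb{S}_+^{d-1}$, satisfying $P_sr_s=\kappa(s)r_s$ and $P_s\nu_s=\kappa(s)\nu_s$ (i.e. $\int P_s\varphi\,d\nu_s=\kappa(s)\int\varphi\,d\nu_s$ for continuous $\varphi$). Set $q_n^s(x,g)=\frac{|gx|^s}{\kappa^n(s)}\frac{r_s(g\cdot x)}{r_s(x)}$; the probability measures $q_n^s(x,g_n\cdots g_1)\mu(dg_1)\cdots\mu(dg_n)$, $n\geq1$, form a projective system and define a unique probability measure $\mathbb{Q}_s^x$ on the space of sequences $\mathcal{M}_+^{\mathbb{N}^*}$. Under $\mathbb{Q}_s^x$ the Markov chain $(X_n^x)_{n\geq0}$ has a unique stationary measure $\pi_s$, given by $\pi_s(\varphi)=\frac{\nu_s(\varphi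 r_s)}{\nu_s(r_s)}$, $\varphi\in\mathcal{C}(\mathbb{S}_+^{d-1})$. *)

(* Defs.v *)
From HB Require Import structures.
From mathcomp Require Import all_boot all_order all_algebra.
From mathcomp Require Import all_classical all_reals all_analysis.
From mathcomp Require Import complex.

Set Implicit Arguments.
Unset Strict Implicit.
Unset Printing Implicit Defensive.

Import Order.TTheory GRing.Theory Num.Theory.
Import numFieldNormedType.Exports.

Local Open Scope classical_set_scope.
Local Open Scope ring_scope.

(* The topological space T with its Borel sigma-algebra. *)
Notation borel T := (g_sigma_algebraType (@open T)).

Section products_of_positive_matrices.
Context {R : realType} {d : nat}.

Definition dotv (x y : 'cV[R]_d) : R := \sum_(i < d) x i 0 * y i 0.

(* The library norm on 'cV[R]_d is the sup norm, hence this definition. *)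
Definition enorm (x : 'cV[R]_d) : R := Num.sqrt (dotv x x).

Definition sphere_nneg : set 'cV[R]_d :=
  [set x : 'cV[R]_d | (forall i, 0 <= x i 0) /\ enorm x = 1].

Definition mx_nneg : set 'M[R]_d := [set g : 'M[R]_d | forall i j, 0 <= g i j].

Definition opnorm (g : 'M[R]_d) : R :=
  sup [set enorm (g *m x) | x in sphere_nneg].

Definition iota_mx (g : 'M[R]_d) : R :=
  inf [set enorm (g *m x) | x in sphere_nneg].

(* In \bar R, 0^-1 = +oo, so N g = +oo when iota_mx g = 0. *)
Definition N_mx (g : 'M[R]_d) : \bar R :=
  maxe (opnorm g)%:E ((iota_mx g)%:E^-1)%E.

(* Total version of g.x; it is 0 when g *m x = 0, where g.x is undefined. *)
Definition proj_act (g : 'M[R]_d) (x : 'cV[R]_d) : 'cV[R]_d :=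
  (enorm (g *m x))^-1 *: (g *m x).

Definition supp {T : ptopologicalType} (m : set T -> \bar R) : set T :=
  [set x | forall U, open U -> U x -> (0 < m U)%E].

(* Laws on mx_nneg and on sphere_nneg are encoded as Borel probability
   measures on the ambient space giving mass 1 to that set. *)
Implicit Types (mu : probability (borel 'M[R]_d) R)
               (nu : probability (borel 'cV[R]_d) R).

Definition Gamma_mu mu : set 'M[R]_d :=
  smallest (fun A : set 'M[R]_d => closed A /\ forall g h, A g -> A h -> A (g *m h)) (supp mu).

Definition I_mu mu : set R :=
  [set s | 0 <= s /\
     (\int[mu]_(g in mx_nneg) (opnorm g `^ s)%:E < +oo)%E].

Definition transfer mu (s : R) (phi : 'cV[R]_d -> R) (x : 'cV[R]_d) : R :=
  \int[mu]_(g in Gamma_mu mu) (enorm (g *m x) `^ s * phi (proj_act g x)).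

(* Test functions in this file are real-valued; by linearity in the real and
   imaginary parts this is the same as testing against complex ones. *)
Definition is_stationary mu nu : Prop :=
  nu sphere_nneg = 1%E /\
  forall phi : 'cV[R]_d -> R, {within sphere_nneg, continuous phi} ->
    \int[nu]_(x in sphere_nneg) (\int[mu]_(g in mx_nneg) phi (proj_act g x))
    = \int[nu]_(x in sphere_nneg) phi x.

Definition is_pos_eigenfunction mu (s kappa : R) (r : 'cV[R]_d -> R) : Prop :=
  [/\ {within sphere_nneg, continuous r},
      forall x, sphere_nneg x -> 0 < r x &
      forall x, sphere_nneg x -> transfer mu s r x = kappa * r x].

Definition is_eigenmeasure mu (s kappa : R) nu : Prop :=
  nu sphere_nneg = 1%E /\
  forall phi : 'cV[R]_d -> R, {within sphere_nneg, continuous phi} ->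
    \int[nu]_(x in sphere_nneg) transfer mu s phi x
    = kappa * \int[nu]_(x in sphere_nneg) phi x.

Definition is_pi (nu_s : probability (borel 'cV[R]_d) R)
    (r : 'cV[R]_d -> R) (pi_s : probability (borel 'cV[R]_d) R) : Prop :=
  pi_s sphere_nneg = 1%E /\
  forall phi : 'cV[R]_d -> R, {within sphere_nneg, continuous phi} ->
    \int[pi_s]_(x in sphere_nneg) phi x
    = (\int[nu_s]_(x in sphere_nneg) (phi x * r x))
      / (\int[nu_s]_(x in sphere_nneg) r x).

Definition moment_cond mu : Prop :=
  exists eta : R, [/\ 0 < eta, eta < 1 &
    (\int[mu]_(g in mx_nneg) (N_mx g `^ eta) < +oo)%E].

Definition col_max (g : 'M[R]_d) (j : 'I_d) : R :=
  \big[Num.max/g j j]_(i < d) g i j.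

Definition col_min (g : 'M[R]_d) (j : 'I_d) : R :=
  \big[Num.min/g j j]_(i < d) g i j.

(* As x / 0 = 0 in R, the lower bound 1 forces col_min g j to be nonzero. *)
Definition column_comparable mu : Prop :=
  forall j : 'I_d, exists C : R, 1 < C /\
    forall g : 'M[R]_d, supp mu g -> 1 <= col_max g j / col_min g j <= C.

(* The inverse is taken in \bar R, so that 0 to the power - delta is +oo. *)
Definition harmonic_moments mu : Prop :=
  forall i j : 'I_d, exists delta : R, 0 < delta /\
    (\int[mu]_(g in mx_nneg) ((g i j `^ delta)%:E)^-1 < +oo)%E.

Definition expi (a : R) : R[i] := Complex (cos a) (sin a).

(* phi = 0 always solves the equation; non-arithmeticity says that for t > 0
   there is no other solution. Here |g x| ^ (i t) is expi (t * ln |g x|). *)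
Definition non_arithmetic mu nu : Prop :=
  forall (t theta : R) (phi : 'cV[R]_d -> R),
    0 < t -> 0 <= theta < 2 * pi ->
    (forall (g : 'M[R]_d) (x : 'cV[R]_d), Gamma_mu mu g -> supp nu x ->
       expi (t * ln (enorm (g *m x))) * (phi (proj_act g x))%:C%C
       = expi theta * (phi x)%:C%C) ->
    forall x : 'cV[R]_d, supp nu x -> phi x = 0.

(* The integrand is +oo where dotv f x = 0. *)
Definition neg_moment_bound nu (alpha : R) : Prop :=
  (ereal_sup [set \int[nu]_(x in sphere_nneg) ((`|dotv f x| `^ alpha)%:E)^-1
             | f in sphere_nneg] < +oo)%E.

Definition small_ball_bound nu (alpha C : R) : Prop :=
  forall t : R, 0 < t < 1 ->
    (ereal_sup [set nu [set x | sphere_nneg x /\ (`|dotv f x| <= t)%R]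
               | f in sphere_nneg] <= (C * t `^ alpha)%:E)%E.

End products_of_positive_matrices.

(* Main.v *)
Require Import Defs.
From HB Require Import structures.
From mathcomp Require Import all_boot all_order all_algebra.
From mathcomp Require Import all_classical all_reals all_analysis.
From mathcomp Require Import measurable_realfun ring lra.
Set Implicit Arguments.
Unset Strict Implicit.
Unset Printing Implicit Defensive.
Import Order.TTheory GRing.Theory Num.Theory.
Import numFieldNormedType.Exports.
Local Open Scope classical_set_scope.
Local Open Scope ring_scope.

(** The transfer operator spreads mass inside the cone: for a matrix g with
    positive entries the quotient of <f, g x> by |g x| is bounded below
    uniformly over f and x in the sphere. As the eigenmeasure satisfies
    kappa * nu_s(phi) = nu_s(P_s phi), a bound on P_s phi, uniform on the sphere,
    bounds nu_s(phi).

    Since |<f, x>|^-a is not a continuous test function, phi is its truncation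
    max(1/(n+1), <f, x>)^-a, and everything has to be uniform in n and f. The
    function to be integrated in P_s phi (x) is
      |g x|^s phi(g.x) <= |g x|^(s + a) l^-a   whenever 0 < l <= <f, g x>,
    and the point is to dominate it by an integrable function h of g alone
    (predicate [dominated]):
    - under column comparability all coordinates of g x are comparable, so
      l can be taken proportional to |g x|, and a = 1, h = D S(g)^s work, where
      S(g) is the sum of the entries of g, which is comparable to ||g||
      ([column_comparable_dominated]);
    - under harmonic moments, each entry of g is at least B(g)^-q with
      B(g) = 1 + sum_ij (g^ij)^-delta_ij integrable. As S(g)^p is integrable for some
      p > s, taking a small enough balances the two factors:
      S^(s + a) B^(q a) <= 1 + S^p + B ([powR_balance], [harmonic_dominated]).

    Then nu_s(phi) <= K / kappa ([eigenmeasure_truncated_bound]), where kappa > 0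
    is seen by testing the eigenmeasure equation on phi = 1: P_s 1 is bounded
    below by a positive constant, namely the integral of a power of a lower bound for
    the entries of g ([kappa_gt0]). The bound passes to pi_s, whose density
    with respect to nu_s is bounded because r_s is continuous and positive on a
    compact set ([pi_truncated_bound]). Monotone convergence in n gives the
    negative moment, and Markov's inequality the estimate on small balls.

    Almost every matrix has to be in the support of mu for the pointwise
    hypotheses to be of use; this holds because the space of matrices is second
    countable ([supp_full], [mx_second_countable]). *)

(** * Integrals of non-negative functions *)

Section nonneg_integral.
Context {R : realType} {dd : measure_display} {T : measurableType dd}.
Variable mu : {measure set T -> \bar R}.

(** The integral of a non-negative function is a supremum over the simple
    functions below it, so it is monotone without any measurability. This is what
    makes it possible to estimate the transfer operator and the operator norm
    without studying their regularity. *)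
Lemma ge0_le_integral_sub (D D' : set T) (f h : T -> \bar R) :
  D `<=` D' -> (forall x, D x -> 0 <= f x)%E -> (forall x, D' x -> 0 <= h x)%E ->
  (forall x, D x -> f x <= h x)%E ->
  (\int[mu]_(x in D) f x <= \int[mu]_(x in D') h x)%E.
Proof.
move=> DD' f0 h0 fh; rewrite !ge0_integralE//; apply: le_ereal_sup => _ /= [k kf <-].
exists k => //= x; apply: (le_trans (kf x)); rewrite /patch.
case: ifPn => [/set_mem Dx|_]; first by rewrite mem_set ?fh//; exact: DD'.
by case: ifPn => // /set_mem /h0.
Qed.

(** The real-valued integral is 0 when the extended one is infinite; this lemma
    and the next one are the only passages between the two, and both require
    finiteness. *)
Lemma Rintegral_le_ereal (D : set T) (f : T -> R) (K : R) :
  (\int[mu]_(x in D) (f x)%:E <= K%:E)%E -> (forall x, D x -> 0 <= f x) ->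
  \int[mu]_(x in D) f x <= K.
Proof.
move=> fK f0; rewrite /Rintegral -[leRHS]/(fine K%:E); apply: fine_le => //.
by rewrite ge0_fin_numE ?(le_lt_trans fK) ?ltry// integral_ge0// => x Dx; rewrite lee_fin f0.
Qed.

Lemma Rintegral_ge_ereal (D : set T) (f : T -> R) (K : \bar R) :
  (\int[mu]_(x in D) (f x)%:E < +oo)%E -> (forall x, D x -> 0 <= f x) ->
  (K <= \int[mu]_(x in D) (f x)%:E)%E ->
  (K <= (\int[mu]_(x in D) f x)%:E)%E.
Proof.
move=> foo f0 Kf; rewrite fineK// ge0_fin_numE//.
by rewrite integral_ge0// => x Dx; rewrite lee_fin f0.
Qed.

Lemma integral_gt0 (E : set T) (f : T -> R) : measurable E -> mu E != 0%E ->
  measurable_fun E f -> (forall x, E x -> 0 < f x) ->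
  (0 < \int[mu]_(x in E) (f x)%:E)%E.
Proof.
move=> mE muE mf f0; rewrite lt_neqAle integral_ge0 ?andbT; last first.
  by move=> x Ex; rewrite lee_fin ltW// f0.
apply/eqP => I0; move/eqP: muE; apply.
have mfE : measurable_fun E (EFin \o f) by exact/measurable_EFinP.
have : (\int[mu]_(x in E) `|(EFin \o f) x| = 0)%E.
  rewrite I0; apply: eq_integral => x /set_mem Ex /=.
  by rewrite ger0_norm// ltW// f0.
move/(ae_eq_integral_abs mu mE mfE) => [N [mN N0 EN]].
apply/eqP; rewrite eq_le measure_ge0 andbT -N0 le_measure ?inE//.
apply: subset_trans EN => x Ex /= /(_ Ex) [fx0].
by have := f0 _ Ex; rewrite fx0 ltxx.
Qed.

Lemma integral_lty_null (D Z : set T) (f : T -> \bar R) :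
  measurable Z -> Z `<=` D -> (forall x, D x -> 0 <= f x)%E ->
  (forall x, Z x -> f x = +oo)%E -> (\int[mu]_(x in D) f x < +oo)%E -> mu Z = 0%E.
Proof.
move=> mZ ZD f0 fZ; apply: contraPP => /eqP muZ.
suff -> : (\int[mu]_(x in D) f x = +oo)%E by rewrite ltxx.
apply/eqP; rewrite -leye_eq.
have <- : (\int[mu]_(x in Z) cst +oo x = +oo)%E.
  by rewrite integral_cst// gt0_mulye// lt0e muZ measure_ge0.
by apply: ge0_le_integral_sub => // [x _|x Zx]; rewrite /cst ?leey// fZ.
Qed.

End nonneg_integral.

(** * Supports of Borel probability measures *)

Section borel_sets.
Context {R : realType} {T : ptopologicalType}.

Lemma open_measurable_borel (U : set T) : open U -> measurable (U : set (borel T)).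
Proof. by move=> oU; apply: sub_sigma_algebra. Qed.

Lemma closed_measurable_borel (F : set T) : closed F -> measurable (F : set (borel T)).
Proof.
move=> cF; rewrite -[F]setCK; apply: measurableC; apply: open_measurable_borel.
by rewrite openC.
Qed.

Lemma continuous_measurable_borel (f : T -> R) (D : set T) :
  measurable (D : set (borel T)) -> continuous f ->
  measurable_fun (D : set (borel T)) f.
Proof.
move=> mD /continuousP cf; apply: (@measurable_funS _ _ _ _ [set: borel T]) => //.
apply: (measurability _ (RGenOpens.measurableE R)).
move=> _ [_ [a [b ->]] <-]; rewrite setTI; apply: open_measurable_borel.
exact/cf/interval_open.
Qed.

Lemma supp_closed (m : set T -> \bar R) : closed (supp m).
Proof.
rewrite -[supp m]setCK; apply: open_closedC; rewrite openE => x /=.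
move=> /existsNP[U /not_implyP[oU /not_implyP[Ux /negP mU]]].
rewrite /interior nbhsE; exists U; first by split.
move=> y Uy /=; apply/existsNP; exists U.
by apply/not_implyP; split => //; apply/not_implyP; split => //; exact/negP.
Qed.

(** The complement of the support is covered by the null sets of a countable
    basis. *)
Lemma supp_full (P : probability (borel T) R) :
  @second_countable T -> P (supp P) = 1%E.
Proof.
move=> [B cB [Bo Bb]].
have ms : measurable (supp P : set (borel T)).
  by apply: closed_measurable_borel; exact: supp_closed.
suff P0 : P (~` supp P) = 0%E.
  by rewrite -[supp P]setCK probability_setC ?P0 ?sube0//; exact: measurableC.
pose B0 := [set U | B U /\ P U = 0%E].
have sB0 : ~` supp P `<=` \bigcup_(U in B0) U.
  move=> x /existsNP[U /not_implyP[oU /not_implyP[Ux /negP]]].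
  rewrite -leNgt => PU; have [V [BV Vx] VU] := Bb x _ (open_nbhs_nbhs (conj oU Ux)).
  exists V => //; split => //; apply/eqP; rewrite eq_le measure_ge0 andbT.
  apply: le_trans PU; apply: le_measure => //; rewrite inE;
    by apply: open_measurable_borel => //; exact: Bo.
have cB0 : countable B0.
  by apply: sub_countable cB; apply: subset_card_le => U [].
apply: (@measure_negligible _ _ _ P); first exact: measurableC.
apply: (@negligibleS _ _ _ P _ _ sB0).
(* A nonempty countable family is the range of a sequence F. *)
have [->|[F]] := pfcard_geP cB0; first by rewrite bigcup_set0; exact: negligible_set0.
have -> : \bigcup_(U in B0) U = \bigcup_n F n.
  by rewrite -[RHS](bigcup_image [set: nat] F id) (image_eq F).
apply: negligible_bigcup => k.
have [BF PF] : B0 (F k) by exact: funS.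
by apply/negligibleP => //; apply: open_measurable_borel; exact: Bo.
Qed.

End borel_sets.

(** * Sets of full probability *)

Section full_sets.
Context {R : realType} {dd : measure_display} {T : measurableType dd}.
Variable P : probability T R.

Lemma negligible_setC_full (E : set T) : measurable E -> P E = 1%E ->
  P.-negligible (~` E).
Proof.
move=> mE PE; apply/negligibleP; first exact: measurableC.
by rewrite [LHS]probability_setC// PE subee.
Qed.

Lemma full_of_negligible (E : set T) : measurable E -> P.-negligible (~` E) -> P E = 1%E.
Proof.
move=> mE /(measure_negligible (measurableC mE)) PE; rewrite -[E]setCK.
by rewrite probability_setC ?PE ?sube0//; exact: measurableC.
Qed.

(** The function equal to h on E and to +oo on the null set ~` E is measurable and
    dominates f on all of D. *)
Lemma integral_le_on_full (D E : set T) (f h : T -> \bar R) :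
  measurable E -> P E = 1%E -> measurable_fun E h ->
  (forall x, D x -> 0 <= f x)%E -> (forall x, E x -> 0 <= h x)%E ->
  (forall x, D x -> E x -> f x <= h x)%E ->
  (\int[P]_(x in D) f x <= \int[P]_(x in E) h x)%E.
Proof.
move=> mE PE mh f0 h0 fh; have mEC : measurable (~` E) := measurableC mE.
pose k : T -> \bar R := (h \_ E \+ cst +oo \_ (~` E))%E.
have kE x : E x -> k x = h x.
  move=> Ex; rewrite /k /patch mem_set// ifN ?adde0//.
  by apply/negP => /set_mem; exact.
have kEC x : ~ E x -> k x = +oo%E.
  by move=> Ex; rewrite /k /patch memNset// mem_set// add0e.
have k0 x : (0 <= k x)%E.
  by have [Ex|Ex] := pselect (E x); [rewrite kE// h0|rewrite kEC].
have mk : measurable_fun setT k.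
  by apply: emeasurable_funD; apply/(measurable_restrictT _ _).1 => //; exact: measurable_cst.
apply: (@le_trans _ _ (\int[P]_(x in setT) k x)%E).
  apply: ge0_le_integral_sub => // x Dx.
  by have [Ex|Ex] := pselect (E x); [rewrite kE// fh|rewrite kEC// leey].
rewrite (@ge0_negligible_integral _ _ _ P _ (~` E))//; last first.
  by rewrite [LHS]probability_setC// PE subee.
by rewrite setTD setCK (eq_integral h)// => x /set_mem /kE.
Qed.

End full_sets.

Section supports.
Context {R : realType} {T : ptopologicalType}.

Lemma supp_sub_closed (P : probability (borel T) R) (F : set T) :
  closed F -> P F = 1%E -> supp P `<=` F.
Proof.
move=> cF PF x xs; apply: contrapT => xF.
have := xs (~` F) (closed_openC cF) xF.
by rewrite [P _]probability_setC ?PF ?subee ?ltxx//; exact: closed_measurable_borel.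
Qed.

End supports.

(** * Topology of matrix spaces *)

Section topology_of_matrices.
Context {R : realType}.

(** Basis: the balls with rational centre and radius 1/(k+1); a ball of radius
    below e/2 containing x is contained in the ball of centre x and radius e. *)
Lemma mx_second_countable (m n : nat) : @second_countable 'M[R]_(m, n).
Proof.
pose bl (q : 'M[rat]_(m, n) * nat) : set 'M[R]_(m, n) :=
  ball (map_mx (@ratr R) q.1 : 'M[R]_(m, n)) (q.2.+1%:R^-1 : R).
exists (range bl); first exact: (sub_countable (card_image_le _ _)).
split=> [_ [q _ <-]|x A]; first exact: ball_open.
move=> /nbhs_ballP[e /= e0 eA].
have [k ke] : exists k : nat, k.+1%:R^-1 < e / 2 :> R.
  have e20 : 0 < e / 2 by rewrite divr_gt0.
  by have [k _ /(_ _ (leqnn k)) ke] := near_infty_natSinv_lt (PosNum e20); exists k.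
have k0 : 0 < k.+1%:R^-1 :> R by rewrite invr_gt0 ltr0n.
have /choice[q qP] (ij : 'I_m * 'I_n) :
    exists q : rat, `|ratr q - x ij.1 ij.2| < k.+1%:R^-1 :> R.
  have xk : x ij.1 ij.2 - k.+1%:R^-1 < x ij.1 ij.2 + k.+1%:R^-1.
    by rewrite ltrD2l (lt_trans _ k0)// oppr_lt0.
  have [q] := rat_in_itvoo xk.
  by rewrite in_itv/= => xq; exists q; rewrite ltr_distl.
pose Q : 'M[rat]_(m, n) := \matrix_(i, j) q (i, j).
exists (bl (Q, k)); first split; first by exists (Q, k).
  by split=> // i j; rewrite !mxE /ball/= -distrC; have := qP (i, j); rewrite distrC.
move=> y [_ yP]; apply: eA; split=> // i j.
have := yP i j; have := qP (i, j); rewrite !mxE /ball/=.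
rewrite distrC => xq qy; apply: le_lt_trans (ler_distD (ratr (q (i, j))) _ _) _.
by rewrite (splitr e); apply: ltrD; [exact: lt_trans ke|exact: lt_trans ke].
Qed.

Lemma trmx_continuous (m n : nat) : continuous (@trmx R m n).
Proof.
move=> x A /nbhs_ballP[e /= e0 eA]; apply/nbhs_ballP; exists e => //= y [_ yP].
by apply: eA; split=> // i j; rewrite !mxE; exact: yP.
Qed.

Lemma continuous_sum (T : topologicalType) (I : Type) (s : seq I) (F : I -> T -> R) :
  (forall i, continuous (F i)) -> continuous (fun x => \sum_(i <- s) F i x).
Proof.
move=> cF x; apply: cvg_big => [|i _]; last exact: cF.
exact: add_continuous.
Qed.

Lemma dotv_continuous (T : topologicalType) (d : nat) (u v : T -> 'cV[R]_d) :
  (forall i, continuous (fun t => u t i 0)) ->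
  (forall i, continuous (fun t => v t i 0)) ->
  continuous (fun t => dotv (u t) (v t)).
Proof.
by move=> cu cv; apply: continuous_sum => i t; apply: continuousM; [exact: cu|exact: cv].
Qed.

Lemma enorm_continuous (T : topologicalType) (d : nat) (u : T -> 'cV[R]_d) :
  (forall i, continuous (fun t => u t i 0)) -> continuous (fun t => enorm (u t)).
Proof.
move=> cu t; rewrite /enorm.
apply: (@continuous_comp _ _ _ (fun t => dotv (u t) (u t)) Num.sqrt).
  exact: dotv_continuous.
exact: sqrt_continuous.
Qed.

End topology_of_matrices.

(** * Euclidean norm and scalar product on the cone *)

Section euclidean_norm.
Context {R : realType} {d : nat}.
Implicit Types (x y f : 'cV[R]_d) (g : 'M[R]_d).

Lemma enorm_ge0 x : 0 <= enorm x. Proof. exact: sqrtr_ge0. Qed.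

Lemma dotvv_ge0 x : 0 <= dotv x x.
Proof. by apply: sumr_ge0 => i _; rewrite -expr2 sqr_ge0. Qed.

Lemma entry_le_enorm x i : `|x i 0| <= enorm x.
Proof.
rewrite /enorm -sqrtr_sqr ler_wsqrtr// /dotv (bigD1 i)//= expr2 lerDl.
by apply: sumr_ge0 => k _; rewrite -expr2 sqr_ge0.
Qed.

Lemma enorm_le_sum x : (forall i, 0 <= x i 0) -> enorm x <= \sum_i x i 0.
Proof.
move=> x0; have s0 : 0 <= \sum_i x i 0 by apply: sumr_ge0.
rewrite -(ler_pXn2r (_ : (0 < 2)%N)) ?nnegrE ?enorm_ge0//.
rewrite sqr_sqrtr ?dotvv_ge0// expr2 /dotv mulr_suml ler_sum// => i _.
by rewrite ler_wpM2l// (bigD1 i)//= lerDl sumr_ge0.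
Qed.

Lemma sphere_sum_ge1 x : sphere_nneg x -> 1 <= \sum_i x i 0.
Proof. by move=> [x0 <-]; exact: enorm_le_sum. Qed.

Lemma sphere_entry_le1 x i : sphere_nneg x -> x i 0 <= 1.
Proof. by move=> [x0 <-]; rewrite (le_trans (ler_norm _))// entry_le_enorm. Qed.

Lemma dotv_ge0 x y : (forall i, 0 <= x i 0) -> (forall i, 0 <= y i 0) -> 0 <= dotv x y.
Proof. by move=> x0 y0; apply: sumr_ge0 => i _; rewrite mulr_ge0. Qed.

Lemma dotvZr x (c : R) y : dotv x (c *: y) = c * dotv x y.
Proof. by rewrite /dotv mulr_sumr; apply: eq_bigr => i _; rewrite mxE; ring. Qed.

(** The coordinates of f add up to at least |f| = 1. *)
Lemma dotv_sphere_ge f y (a : R) : sphere_nneg f -> 0 <= a ->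
  (forall i, a <= y i 0) -> a <= dotv f y.
Proof.
move=> fS a0 ay; apply: (@le_trans _ _ (\sum_i f i 0 * a)).
  by rewrite -mulr_suml ler_peMl// sphere_sum_ge1.
by apply: ler_sum => i _; rewrite ler_wpM2l//; exact: fS.1.
Qed.

Lemma mulmx_nneg g x : mx_nneg g -> (forall i, 0 <= x i 0) ->
  forall i, 0 <= (g *m x) i 0.
Proof. by move=> g0 x0 i; rewrite mxE sumr_ge0// => j _; rewrite mulr_ge0. Qed.

(** A stand-in for the norm of g which is obviously continuous, hence measurable. *)
Definition entry_sum g : R := \sum_i \sum_j g i j.

Lemma entry_sum_ge0 g : mx_nneg g -> 0 <= entry_sum g.
Proof. by move=> g0; apply: sumr_ge0 => i _; apply: sumr_ge0. Qed.

Lemma entry_sum_continuous : continuous entry_sum.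
Proof. by do 2 apply: continuous_sum => ?; exact: coord_continuous. Qed.

Lemma enorm_le_entry_sum g x : mx_nneg g -> sphere_nneg x ->
  enorm (g *m x) <= entry_sum g.
Proof.
move=> g0 xS; apply: le_trans (enorm_le_sum _) _.
  by apply: mulmx_nneg => //; exact: xS.1.
apply: ler_sum => i _; rewrite mxE; apply: ler_sum => j _.
by rewrite ler_piMr// sphere_entry_le1.
Qed.

Definition basis_vec (j : 'I_d) : 'cV[R]_d := delta_mx j 0.

Lemma basis_vec_sphere j : sphere_nneg (basis_vec j).
Proof.
split=> [i|]; first by rewrite mxE ler0n.
rewrite /enorm /dotv (bigD1 j)//= big1 ?addr0 => [|i ij].
  by rewrite mxE !eqxx mulr1 sqrtr1.
by rewrite mxE (negbTE ij) mul0r.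
Qed.

Lemma mul_basis_vec g i j : (g *m basis_vec j) i 0 = g i j.
Proof.
rewrite mxE (bigD1 j)//= mxE !eqxx mulr1 big1 ?addr0// => k kj.
by rewrite mxE (negbTE kj) mulr0.
Qed.

(** Testing g on the vectors of the canonical basis bounds each entry. *)
Lemma entry_sum_le_opnorm g : mx_nneg g -> entry_sum g <= (d * d)%:R * opnorm g.
Proof.
move=> g0; have gij i j : g i j <= opnorm g.
  rewrite -(mul_basis_vec g i j) (le_trans (ler_norm _))//.
  apply: le_trans (entry_le_enorm _ _) _.
  apply: ub_le_sup; last by exists (basis_vec j) => //; exact: basis_vec_sphere.
  by exists (entry_sum g) => _ [x xS <-]; exact: enorm_le_entry_sum.
apply: (@le_trans _ _ (\sum_(i < d) \sum_(j < d) opnorm g)).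
  by apply: ler_sum => i _; exact: ler_sum.
by rewrite !sumr_const !card_ord -!mulrnA mulr_natl.
Qed.

Lemma sphere_closed : closed (sphere_nneg : set 'cV[R]_d).
Proof.
have -> : (sphere_nneg : set 'cV[R]_d) =
    (\bigcap_(i in [set: 'I_d]) [set x : 'cV[R]_d | 0 <= x i 0]) `&`
    (@enorm R d @^-1` [set 1]).
  by apply/seteqP; split=> x [] /= x0 x1; split=> // i; [move=> _|]; exact: x0.
apply: closedI.
  apply: closed_bigI => i _.
  apply: (@preimage_closed _ _ (fun x : 'cV[R]_d => x i 0) [set y | 0 <= y]).
    by move=> x _; exact: coord_continuous.
  exact: closed_ge.
apply: preimage_closed; last exact: closed_eq.
by move=> x _; apply: enorm_continuous => i; exact: coord_continuous.
Qed.

(** Transposition transports the compactness of bounded closed sets of row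
    vectors. *)
Lemma sphere_compact : compact (sphere_nneg : set 'cV[R]_d).
Proof.
pose A : set 'rV[R]_d := trmx @^-1` sphere_nneg.
have -> : (sphere_nneg : set 'cV[R]_d) = trmx @` A.
  by apply/seteqP; split=> [x xS|_ [v vA <-]//]; exists x^T; rewrite /A/= ?trmxK.
apply: continuous_compact.
  by apply: continuous_subspaceT; exact: trmx_continuous.
apply: bounded_closed_compact.
  exists 1; split; first exact: num_real.
  move=> M M1 v vA; rewrite /= [leLHS]mx_normrE; apply/bigmax_leP; split=> [|[i j] _ /=].
    by rewrite (le_trans _ (ltW M1)).
  have vS : sphere_nneg v^T by exact: vA.
  have -> : v i j = v^T j 0 by rewrite mxE (ord1 i).
  rewrite (le_trans _ (ltW M1))// ger0_norm ?sphere_entry_le1//.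
  by have [v0 _] := vS; exact: v0.
apply: preimage_closed; last exact: sphere_closed.
by move=> x _; exact: trmx_continuous.
Qed.

Lemma mx_nneg_closed : closed (mx_nneg : set 'M[R]_d).
Proof.
have -> : (mx_nneg : set 'M[R]_d) =
    \bigcap_(p in [set: 'I_d * 'I_d]) [set g : 'M[R]_d | 0 <= g p.1 p.2].
  by apply/seteqP; split=> g /= g0 => [p _|i j]; [exact: g0|exact: (g0 (i, j))].
apply: closed_bigI => p _.
apply: (@preimage_closed _ _ (fun x : 'M[R]_d => x p.1 p.2) [set y | 0 <= y]).
  by move=> x _; exact: coord_continuous.
exact: closed_ge.
Qed.

End euclidean_norm.

(** * Truncations of the potential *)

Section truncated_potential.
Context {R : realType}.

(** If B^(q a) is at most max(1, S)^((p - s)/2), the product is at most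
    max(1, S)^p. Otherwise max(1, S) is at most a power of B with exponent
    proportional to a, and for a small the whole product is at most B. *)
Lemma powR_balance (s p q : R) : 0 <= s -> s < p -> 0 < q ->
  exists2 a : R, 0 < a & forall S B : R, 0 <= S -> 1 <= B ->
    S `^ (s + a) * (B `^ q) `^ a <= 1 + S `^ p + B.
Proof.
move=> s0 sp q0; pose e := p - s; have e0 : 0 < e by rewrite subr_gt0.
(* With this c, the exponent of B in the second case is a * c. *)
pose c := q * (2 / e * (s + e / 2) + 1).
have e20 : 0 < e / 2 by rewrite divr_gt0.
have se0 : 0 <= s + e / 2 by rewrite addr_ge0// ltW.
have c0 : 0 < c by rewrite mulr_gt0// ltr_wpDl// mulr_ge0// divr_ge0// ltW.
pose a := Num.min (e / 2) c^-1.
have a0 : 0 < a by rewrite lt_min e20 invr_gt0.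
exists a => // S B S0 B1; pose A := Num.max 1 S.
have A1 : 1 <= A by rewrite le_max lexx.
have Agt0 : 0 < A := lt_le_trans ltr01 A1.
have A0 := ltW Agt0.
have B0 : 0 < B := lt_le_trans ltr01 B1.
have ae : a <= e / 2 by rewrite ge_min lexx.
have SA : S `^ (s + a) * (B `^ q) `^ a <= A `^ (s + e / 2) * B `^ (q * a).
  rewrite powRrM ler_wpM2r ?powR_ge0//.
  apply: (@le_trans _ _ (A `^ (s + a))).
    by rewrite ge0_ler_powR ?nnegrE ?addr_ge0 ?(ltW a0)// le_max lexx orbT.
  by rewrite ler_powR// lerD2l.
apply: le_trans SA _.
have [BA|/ltW AB] := leP (B `^ (q * a)) (A `^ (e / 2)).
  apply: (@le_trans _ _ (A `^ p)).
    have -> : p = (s + e / 2) + e / 2 by rewrite /e; field.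
    by rewrite [leRHS]powRD ?(gt_eqF Agt0) ?implybT// ler_wpM2l ?powR_ge0.
  apply: (@le_trans _ _ (1 + S `^ p)); last by rewrite lerDl ltW.
  rewrite /A; have [_|_] := leP 1 S; last by rewrite powR1 lerDl powR_ge0.
  by rewrite lerDr ler01.
apply: (@le_trans _ _ B); last by rewrite lerDr addr_ge0 ?powR_ge0.
have AB' : A <= B `^ (2 / e * (q * a)).
  have -> : A = (A `^ (e / 2)) `^ (2 / e).
    by rewrite -powRrM (_ : e / 2 * _ = 1) ?powRr1//; field; rewrite gt_eqF.
  rewrite [2 / e * _]mulrC [leRHS]powRrM.
  by rewrite ge0_ler_powR ?nnegrE ?powR_ge0 ?divr_ge0 ?(ltW e0).
apply: (@le_trans _ _ (B `^ (2 / e * (q * a) * (s + e / 2) + q * a))).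
  rewrite [leRHS]powRD ?(gt_eqF B0) ?implybT// ler_wpM2r ?powR_ge0// [leRHS]powRrM.
  by rewrite ge0_ler_powR ?nnegrE ?powR_ge0.
rewrite -[leRHS]powRr1 ?(ltW B0)// ler_powR//.
rewrite (_ : _ + _ = a * c); last by rewrite /c; ring.
by rewrite -ler_pdivlMr// div1r ge_min lexx orbT.
Qed.

Context {d : nat}.
Implicit Types (f y : 'cV[R]_d).

Definition truncated_potential (a : R) (n : nat) f y : R :=
  (Num.max n.+1%:R^-1 (dotv f y)) `^ (- a).

Lemma trunc_arg_gt0 n f y : 0 < Num.max (n.+1%:R^-1 : R) (dotv f y).
Proof. by rewrite lt_max invr_gt0 ltr0n. Qed.

Lemma truncated_potential_ge0 a n f y : 0 <= truncated_potential a n f y.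
Proof. exact: powR_ge0. Qed.

Lemma ler_powRN (a u v : R) : 0 <= a -> 0 < u -> u <= v -> v `^ (- a) <= u `^ (- a).
Proof.
move=> a0 u0 uv; have v0 := lt_le_trans u0 uv.
rewrite !powRN lef_pV2 ?posrE ?powR_gt0//.
by rewrite ge0_ler_powR ?nnegrE// ltW.
Qed.

Lemma truncated_potential_le (a : R) n f y (u : R) : 0 <= a -> 0 < u ->
  u <= Num.max n.+1%:R^-1 (dotv f y) -> truncated_potential a n f y <= u `^ (- a).
Proof. by move=> a0 u0 uy; exact: ler_powRN. Qed.

Lemma truncated_potential_continuous a n f : continuous (truncated_potential a n f).
Proof.
have -> : truncated_potential a n f =
    (fun y => expR (- a * ln (Num.max n.+1%:R^-1 (dotv f y)))).
  by apply/funext => y; rewrite /truncated_potential /powR gt_eqF ?trunc_arg_gt0.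
move=> y; apply: (@continuous_comp _ _ _
  (fun y => - a * ln (Num.max n.+1%:R^-1 (dotv f y))) (@expR R)); last first.
  exact: continuous_expR.
apply: (@continuousM R _ (fun=> - a)); first exact: cst_continuous.
apply: (@continuous_comp _ _ _ (fun y => Num.max n.+1%:R^-1 (dotv f y)) (@ln R)); last first.
  by apply: continuous_ln; exact: trunc_arg_gt0.
apply: (@continuous_max R _ (fun=> n.+1%:R^-1) (dotv f)); first exact: cst_continuous.
by apply: dotv_continuous => i ?; [exact: cst_continuous|exact: coord_continuous].
Qed.

Lemma truncated_potential_proj_act_le (a s : R) n f (g : 'M[R]_d) (x : 'cV[R]_d) (l : R) :
  0 <= a -> 0 <= s -> 0 < l -> 0 < enorm (g *m x) -> l <= dotv f (g *m x) ->
  enorm (g *m x) `^ s * truncated_potential a n f (proj_act g x)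
  <= enorm (g *m x) `^ (s + a) * (l^-1) `^ a.
Proof.
move=> a0 s0 l0 e0 lf; set e := enorm _ in e0 *.
have el0 : 0 < e^-1 * l by rewrite mulr_gt0 ?invr_gt0.
rewrite powRD ?(gt_eqF e0) ?implybT// -mulrA ler_wpM2l ?powR_ge0//.
apply: (@le_trans _ _ ((e^-1 * l) `^ (- a))).
  apply: truncated_potential_le => //.
  by rewrite le_max dotvZr ler_pM2l ?invr_gt0// lf orbT.
rewrite -powRM ?invr_ge0 ?(ltW e0) ?(ltW l0)//.
rewrite -[e * l^-1]invrK -[X in _ <= X `^ _]powR_inv1 ?invr_ge0 ?mulr_ge0 ?invr_ge0 ?(ltW e0) ?(ltW l0)//.
by rewrite -powRrM mulN1r invfM invrK.
Qed.

(** The truncations exhaust the potential: for <f, y> > 0 one of them already has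
    its value, and for <f, y> = 0 they are the powers (n+1)^a. *)
Lemma inv_powR_le_sup_trunc (a : R) f y : 0 < a -> 0 <= dotv f y ->
  (((`|dotv f y| `^ a)%:E)^-1 <=
   ereal_sup (range (fun n => (truncated_potential a n f y)%:E)))%E.
Proof.
move=> a0; rewrite le_eqVlt => /predU1P[fy0|fy0].
  rewrite -fy0 normr0 powR0 ?gt_eqF// inve0.
  suff -> : ereal_sup (range (fun n => (truncated_potential a n f y)%:E)) = +oo%E by [].
  apply/eqyP => A A0; apply: le_ereal_sup_tmp.
  (* The n-th truncation is (n+1)^a, which is above A for this n. *)
  pose n := Num.Def.archi_bound (A `^ a^-1).
  exists (truncated_potential a n f y)%:E; first by exists n.
  have nA : A `^ a^-1 <= n.+1%:R.
    by rewrite ltW// (lt_trans (archi_boundP (powR_ge0 _ _)))// ltr_nat.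
  rewrite lee_fin /truncated_potential -fy0 max_l ?invr_ge0 ?ler0n//.
  rewrite -powR_inv1 ?ler0n// -powRrM mulrNN mul1r.
  have -> : A = (A `^ a^-1) `^ a by rewrite -powRrM mulVf ?gt_eqF// powRr1 ?ltW.
  by rewrite ge0_ler_powR ?nnegrE ?powR_ge0 ?ler0n ?(ltW a0).
rewrite (gtr0_norm fy0) inver gt_eqF ?powR_gt0// -powRN.
apply: le_ereal_sup_tmp.
have [n _ /(_ _ (leqnn n)) nf] := near_infty_natSinv_lt (PosNum fy0).
exists (truncated_potential a n f y)%:E; first by exists n.
by rewrite lee_fin /truncated_potential max_r// ltW.
Qed.

Lemma truncated_potential_nd a f y : 0 <= a ->
  nondecreasing_seq (fun n => (truncated_potential a n f y)%:E).
Proof.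
move=> a0 m n mn; rewrite lee_fin; apply: ler_powRN => //; first exact: trunc_arg_gt0.
rewrite ge_max !le_max lexx orbT andbT lef_pV2 ?posrE ?ltr0n// ler_nat ltnS.
by rewrite mn.
Qed.

End truncated_potential.

(** * From truncations to negative moments and small balls *)

Section measures_on_the_sphere.
Context {R : realType} {d : nat}.
Variable nu : probability (borel 'cV[R]_d) R.

Lemma sphere_measurable : measurable (sphere_nneg : set (borel 'cV[R]_d)).
Proof. by apply: closed_measurable_borel; exact: sphere_closed. Qed.

Lemma truncated_potential_measurable a n f :
  measurable_fun (sphere_nneg : set (borel 'cV[R]_d)) (truncated_potential a n f).
Proof.
apply: continuous_measurable_borel; first exact: sphere_measurable.
exact: truncated_potential_continuous.
Qed.

Lemma neg_moment_bound_of_truncations (a M : R) : 0 < a ->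
  (forall f n, sphere_nneg f ->
    (\int[nu]_(x in sphere_nneg) (truncated_potential a n f x)%:E <= M%:E)%E) ->
  neg_moment_bound nu a.
Proof.
move=> a0 H; apply: le_lt_trans (ltry M); apply: ge_ereal_sup => _ [f fS <-].
have nd x := truncated_potential_nd f x (ltW a0).
apply: (@le_trans _ _ (\int[nu]_(x in sphere_nneg)
    limn (fun n => (truncated_potential a n f x)%:E))%E).
  have lim_sup x : (limn (fun n => (truncated_potential a n f x)%:E) =
      ereal_sup (range (fun n => (truncated_potential a n f x)%:E)))%E.
    by apply/cvg_lim => //; exact: ereal_nondecreasing_cvgn.
  have le x : sphere_nneg x -> (((`|dotv f x| `^ a)%:E)^-1 <=
      limn (fun n => (truncated_potential a n f x)%:E))%E.
    move=> xS; rewrite lim_sup; apply: inv_powR_le_sup_trunc => //.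
    by apply: dotv_ge0; [exact: fS.1|exact: xS.1].
  apply: ge0_le_integral_sub => // x xS; first by rewrite inve_ge0 lee_fin powR_ge0.
  by apply: le_trans (le x xS); rewrite inve_ge0 lee_fin powR_ge0.
rewrite monotone_convergence//.
- apply: lime_le; last by apply: nearW => n; exact: H.
  apply: ereal_nondecreasing_is_cvgn => m n mn.
  apply: ge0_le_integral_sub => // x xS; rewrite ?lee_fin ?truncated_potential_ge0//.
  exact: nd.
- exact: sphere_measurable.
- by move=> n; apply/measurable_EFinP; exact: truncated_potential_measurable.
- by move=> n x _; rewrite lee_fin truncated_potential_ge0.
Qed.

(** Markov's inequality: |<f, x>|^-a is at least t^-a on the ball. *)
Lemma small_ball_of_neg_moment (a : R) : 0 < a -> neg_moment_bound nu a ->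
  exists2 C : R, 0 < C & small_ball_bound nu a C.
Proof.
move=> a0; rewrite /neg_moment_bound; set Sup := ereal_sup _ => Supoo.
have [C C0 SC] : exists2 C : R, 0 < C & (Sup <= C%:E)%E.
  case: Sup Supoo => [r _| |_]; [|by rewrite ltxx|by exists 1; rewrite ?leNye].
  by exists (`|r| + 1); [rewrite ltr_wpDl|rewrite lee_fin (le_trans (ler_norm r))// lerDl].
exists C => // t /andP[t0 _]; apply: ge_ereal_sup => _ [f fS <-].
set A := [set x | _].
have mA : measurable (A : set (borel 'cV[R]_d)).
  have -> : A = sphere_nneg `&` [set x | `|dotv f x| <= t] by [].
  apply: closed_measurable_borel; apply: closedI; first exact: sphere_closed.
  apply: (@preimage_closed _ _ (fun x => `|dotv f x|) [set y | y <= t]); last exact: closed_le.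
  move=> x _; apply: (@continuous_comp _ _ _ (dotv f) Num.norm); last exact: norm_continuous.
  by apply: dotv_continuous => i ?; [exact: cst_continuous|exact: coord_continuous].
rewrite EFinM muleC -lee_pdivrMl ?powR_gt0//; apply: le_trans SC.
apply: (@le_trans _ _ (\int[nu]_(x in sphere_nneg) ((`|dotv f x| `^ a)%:E)^-1)%E); last first.
  by apply: ereal_sup_ubound; exists f.
rewrite -integral_cst//; apply: ge0_le_integral_sub => //.
- by move=> x [].
- by move=> x _; rewrite lee_fin invr_ge0 powR_ge0.
- by move=> x _; rewrite inve_ge0 lee_fin powR_ge0.
move=> x [_ xt]; rewrite /cst inver; case: ifPn => [_|fx0]; first exact: leey.
have fx : 0 < `|dotv f x| `^ a by rewrite lt_neqAle eq_sym fx0 powR_ge0.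
rewrite lee_fin lef_pV2 ?posrE ?fx ?(powR_gt0 _ t0)//.
by rewrite ge0_ler_powR ?nnegrE ?(ltW a0) ?(ltW t0).
Qed.

End measures_on_the_sphere.

(** * Lower bounds for positive matrices *)

Section positive_matrices.
Context {R : realType} {d : nat}.
Implicit Types (g : 'M[R]_d) (x f : 'cV[R]_d).

Lemma measurable_entry_sum_powR (D : set 'M[R]_d) (p : R) :
  measurable (D : set (borel 'M[R]_d)) ->
  measurable_fun (D : set (borel 'M[R]_d)) (fun g => entry_sum g `^ p).
Proof.
move=> mD; apply: (measurableT_comp (@measurable_powR R p)).
by apply: continuous_measurable_borel => //; exact: entry_sum_continuous.
Qed.

Lemma measurable_entry_powR (D : set 'M[R]_d) (p : R) i j :
  measurable (D : set (borel 'M[R]_d)) ->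
  measurable_fun (D : set (borel 'M[R]_d)) (fun g => g i j `^ p).
Proof.
move=> mD; apply: (measurableT_comp (@measurable_powR R p)).
by apply: continuous_measurable_borel => //; exact: coord_continuous.
Qed.

(** A measurable quantity whose powers bound all the entries of g from below at
    once, each entry being allowed its own exponent. *)
Definition recip_sum (e : 'I_d -> 'I_d -> R) g : R :=
  1 + \sum_i \sum_j g i j `^ (- e i j).

Lemma recip_sum_ge1 e g : 1 <= recip_sum e g.
Proof. by rewrite lerDl; do 2 apply: sumr_ge0 => ? _; exact: powR_ge0. Qed.

Lemma measurable_recip_sum (D : set 'M[R]_d) e :
  measurable (D : set (borel 'M[R]_d)) ->
  measurable_fun (D : set (borel 'M[R]_d)) (recip_sum e).
Proof.
move=> mD; apply: measurable_funD; first exact: measurable_cst.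
by do 2 apply: measurable_sum => ?; exact: measurable_entry_powR.
Qed.

(** The (i, j) summand alone is at most the sum, hence 1 / g i j is at most its
    power of exponent 1 / e i j; the sum is at least 1, which allows raising this
    exponent to a common q. *)
Lemma recip_sum_entry e (q : R) g i j : (forall i j, 0 < g i j) ->
  0 < e i j -> (e i j)^-1 <= q -> (recip_sum e g `^ q)^-1 <= g i j.
Proof.
move=> g0 e0 eq; have B1 := recip_sum_ge1 e g.
have B0 : 0 < recip_sum e g := lt_le_trans ltr01 B1.
rewrite -[leRHS]invrK lef_pV2 ?posrE ?powR_gt0 ?invr_gt0//.
apply: (@le_trans _ _ (recip_sum e g `^ (e i j)^-1)); last exact: ler_powR.
have -> : (g i j)^-1 = (g i j `^ (- e i j)) `^ (e i j)^-1.
  by rewrite -powRrM mulNr mulfV ?gt_eqF// powR_inv1// ltW.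
rewrite ge0_ler_powR ?nnegrE ?powR_ge0 ?invr_ge0 ?(ltW e0) ?(ltW B0)//.
rewrite /recip_sum (bigD1 i)//= (bigD1 j)//=.
have X0 : 0 <= \sum_(k < d | k != j) g i k `^ (- e i k).
  by apply: sumr_ge0 => ? _; exact: powR_ge0.
have Y0 : 0 <= \sum_(k < d | k != i) \sum_(l < d) g k l `^ (- e k l).
  by do 2 apply: sumr_ge0 => ? _; exact: powR_ge0.
lra.
Qed.

(** The coordinates of x add up to at least 1. *)
Lemma mulmx_entry_ge g x (l : R) : sphere_nneg x -> 0 <= l ->
  (forall i j, l <= g i j) -> forall i, l <= (g *m x) i 0.
Proof.
move=> xS l0 lg i; rewrite mxE; apply: (@le_trans _ _ (\sum_j l * x j 0)).
  by rewrite -mulr_sumr ler_peMr// sphere_sum_ge1.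
by apply: ler_sum => j _; rewrite ler_wpM2r//; exact: xS.1.
Qed.

Lemma enorm_ge_entry x (l : R) i : l <= x i 0 -> l <= enorm x.
Proof. by move=> /le_trans; apply; apply: le_trans (entry_le_enorm x i); exact: ler_norm. Qed.

Lemma sphere_index x : sphere_nneg x -> exists i : 'I_d, 0 < x i 0.
Proof.
move=> xS; apply: contrapT => /forallNP H; have := sphere_sum_ge1 xS.
rewrite big1 ?ler10// => i _; apply/eqP; rewrite eq_le xS.1 andbT leNgt.
exact/negP/H.
Qed.

End positive_matrices.

(** * Support, semigroup and moments of the law *)

Section support_and_semigroup.
Context {R : realType} {d : nat}.
Variable mu : probability (borel 'M[R]_d) R.
Hypothesis mu_nneg : mu mx_nneg = 1%E.

Lemma supp_nneg : supp mu `<=` mx_nneg.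
Proof. by apply: supp_sub_closed => //; exact: mx_nneg_closed. Qed.

Lemma supp_sub_Gamma : supp mu `<=` Gamma_mu mu.
Proof. by move=> g sg A [_]; exact. Qed.

Lemma Gamma_sub_nneg : Gamma_mu mu `<=` mx_nneg.
Proof.
apply: smallest_sub; last exact: supp_nneg.
split; first exact: mx_nneg_closed.
by move=> g h g0 h0 i j; rewrite mxE sumr_ge0// => k _; rewrite mulr_ge0.
Qed.

Lemma measurable_mx_nneg : measurable (mx_nneg : set (borel 'M[R]_d)).
Proof. by apply: closed_measurable_borel; exact: mx_nneg_closed. Qed.

Lemma opnorm_ge0 (g : 'M[R]_d) : (0 < d)%N -> mx_nneg g -> 0 <= opnorm g.
Proof.
move=> d0 g0; have := le_trans (entry_sum_ge0 g0) (entry_sum_le_opnorm g0).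
by rewrite pmulr_rge0// ltr0n muln_gt0 d0.
Qed.

(** The measurable function [entry_sum] is what the homogeneity of the integral
    can be applied to; the operator norm only enters by comparison. *)
Lemma entry_sum_moment (p : R) : (0 < d)%N -> 0 <= p ->
  (\int[mu]_(g in mx_nneg) (opnorm g `^ p)%:E < +oo)%E ->
  (\int[mu]_(g in mx_nneg) (entry_sum g `^ p)%:E < +oo)%E.
Proof.
move=> d0 p0 H; pose c : R := ((d * d)%:R `^ p)^-1.
have c0 : 0 < c by rewrite invr_gt0 powR_gt0// ltr0n muln_gt0 d0.
have : (\int[mu]_(g in mx_nneg) (c%:E * (entry_sum g `^ p)%:E) < +oo)%E.
  apply: le_lt_trans H; apply: ge0_le_integral_sub => // g g0.
  - by rewrite -EFinM lee_fin mulr_ge0 ?powR_ge0// ltW.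
  - by rewrite lee_fin powR_ge0.
  rewrite -EFinM lee_fin ler_pdivrMl ?powR_gt0 ?ltr0n ?muln_gt0 ?d0//.
  rewrite -powRM ?ler0n ?opnorm_ge0// ge0_ler_powR ?nnegrE ?entry_sum_ge0//.
    by rewrite mulr_ge0 ?ler0n ?opnorm_ge0.
  exact: entry_sum_le_opnorm.
rewrite ge0_integralZl//.
- set I := (integral _ _ _); case: I => [r _|/=|_]; rewrite ?ltry ?ltNyr//.
  by rewrite gt0_muley.
- exact: measurable_mx_nneg.
- by apply/measurable_EFinP; apply: measurable_entry_sum_powR; exact: measurable_mx_nneg.
- by move=> g _; rewrite lee_fin powR_ge0.
- by rewrite lee_fin ltW.
Qed.

End support_and_semigroup.

(** * Uniform bounds for the eigenmeasure *)

Section eigenmeasure_bound.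
Context {R : realType} {d : nat}.
Variables (mu : probability (borel 'M[R]_d) R) (s kappa : R).
Variable nu : probability (borel 'cV[R]_d) R.
Variable E : set 'M[R]_d.
Hypothesis mu_nneg : mu mx_nneg = 1%E.
Hypothesis s_ge0 : 0 <= s.
Hypothesis mE : measurable (E : set (borel 'M[R]_d)).
Hypothesis muE : mu E = 1%E.
Hypothesis E_supp : E `<=` supp mu.
Hypothesis E_pos : forall g, E g -> forall i j, 0 < g i j.
Hypothesis moment_s : (\int[mu]_(g in mx_nneg) (entry_sum g `^ s)%:E < +oo)%E.
Hypothesis nu_eigen : is_eigenmeasure mu s kappa nu.

Lemma sphere_integral_le (P : probability (borel 'cV[R]_d) R) (f : 'cV[R]_d -> R) (K : R) :
  P sphere_nneg = 1%E -> (forall x, sphere_nneg x -> 0 <= f x <= K) ->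
  (\int[P]_(x in sphere_nneg) (f x)%:E <= K%:E)%E.
Proof.
move=> P1 fK; have [K0|K0] := leP 0 K.
  rewrite -[leRHS]mule1 -P1 -integral_cst; last exact: sphere_measurable.
  by apply: ge0_le_integral_sub => // x xS; rewrite lee_fin; case/andP: (fK x xS).
have S0 (x : 'cV[R]_d) : ~ sphere_nneg x.
  by move=> xS; case/andP: (fK x xS) => f0 /(le_trans f0); rewrite leNgt K0.
by move: P1; rewrite (_ : sphere_nneg = set0) ?measure0 => [/esym/eqP|];
  [rewrite onee_eq0|rewrite -subset0 => x /S0].
Qed.

Lemma sphere_integral_ge (P : probability (borel 'cV[R]_d) R) (f : 'cV[R]_d -> R) (K : R) :
  P sphere_nneg = 1%E -> 0 <= K -> (forall x, sphere_nneg x -> K <= f x) ->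
  (K%:E <= \int[P]_(x in sphere_nneg) (f x)%:E)%E.
Proof.
move=> P1 K0 fK.
rewrite -[leLHS]mule1 -P1 -integral_cst; last exact: sphere_measurable.
by apply: ge0_le_integral_sub => // x xS; rewrite lee_fin ?(le_trans K0)// fK.
Qed.

(** Testing on the constant 1 gives kappa as the mean of P_s 1. The constant is
    preferred to the eigenfunction because it is also non-negative at the
    meaningless value of g.x when g x = 0, so that P_s 1 (x) can be bounded below
    by an integral over E only. *)
Lemma kappa_gt0 : 0 < kappa.
Proof.
have [nuS eig] := nu_eigen; pose e1 : 'I_d -> 'I_d -> R := fun _ _ => 1.
pose k g := recip_sum e1 g `^ (- s).
have mk : measurable_fun (E : set (borel 'M[R]_d)) k.
  apply: (measurableT_comp (@measurable_powR R (- s))).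
  exact: measurable_recip_sum.
have B0 g : 0 < recip_sum e1 g := lt_le_trans ltr01 (recip_sum_ge1 e1 g).
(* k g is a power of a lower bound of |g x|, valid for all x at once. *)
have [c c0 cI] : exists2 c : R, 0 < c & (c%:E <= \int[mu]_(g in E) (k g)%:E)%E.
  have : (0 < \int[mu]_(g in E) (k g)%:E)%E.
    apply: integral_gt0 => //; first by rewrite [X in X != _]muE onee_neq0.
    by move=> g _; rewrite powR_gt0.
  case: (integral _ _ _) => [u|_|]//; last by exists 1; rewrite ?leey.
  by rewrite lte_fin => u0; exists u.
pose T1 := transfer mu s (fun=> 1).
have T1_bound x : sphere_nneg x ->
    (\int[mu]_(g in Gamma_mu mu) (enorm (g *m x) `^ s * 1)%:E <=
     \int[mu]_(g in mx_nneg) (entry_sum g `^ s)%:E)%E.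
  move=> xS; apply: ge0_le_integral_sub; first exact: Gamma_sub_nneg.
  - by move=> g _; rewrite lee_fin mulr1 powR_ge0.
  - by move=> g _; rewrite lee_fin powR_ge0.
  move=> g /(Gamma_sub_nneg mu_nneg) g0; rewrite lee_fin mulr1.
  by rewrite ge0_ler_powR ?nnegrE ?enorm_ge0 ?entry_sum_ge0// enorm_le_entry_sum.
have T1_ge x : sphere_nneg x -> c <= T1 x.
  move=> xS; rewrite -lee_fin; apply: Rintegral_ge_ereal.
  - exact: le_lt_trans (T1_bound x xS) moment_s.
  - by move=> g _; rewrite mulr1 powR_ge0.
  apply: le_trans cI _; apply: ge0_le_integral_sub.
  - by move=> g /E_supp; exact: supp_sub_Gamma.
  - by move=> g _; rewrite lee_fin powR_ge0.
  - by move=> g _; rewrite lee_fin mulr1 powR_ge0.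
  move=> g Eg; rewrite lee_fin mulr1 /k -mulN1r powRrM powR_inv1 ?(ltW (B0 g))//.
  have [i _] := sphere_index xS.
  rewrite ge0_ler_powR ?nnegrE ?invr_ge0 ?enorm_ge0 ?(ltW (B0 g))//.
  apply: (@enorm_ge_entry _ _ _ _ i); apply: mulmx_entry_ge => // [|i' j'].
    by rewrite invr_ge0 ltW.
  rewrite -[recip_sum e1 g]powRr1 ?(ltW (B0 g))//.
  by apply: recip_sum_entry; rewrite ?ltr01 ?invr1//; exact: E_pos.
pose K := fine (\int[mu]_(g in mx_nneg) (entry_sum g `^ s)%:E)%E.
have T1_le x : sphere_nneg x -> T1 x <= K.
  move=> xS; apply: Rintegral_le_ereal; last by move=> g _; rewrite mulr1 powR_ge0.
  rewrite fineK ?T1_bound// ge0_fin_numE// integral_ge0// => g _.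
  by rewrite lee_fin powR_ge0.
have c1 : {within sphere_nneg, continuous ((fun=> 1) : 'cV[R]_d -> R)}.
  by apply: continuous_subspaceT => x; exact: cst_continuous.
have := eig _ c1.
have -> : \int[nu]_(x in sphere_nneg) (fun=> 1 : R) x = 1.
  rewrite /Rintegral (integral_cst nu sphere_measurable 1%E) mul1e.
  by rewrite [X in fine X]nuS.
rewrite mulr1 => <-; apply: (lt_le_trans c0); rewrite -lee_fin.
apply: Rintegral_ge_ereal.
- apply: le_lt_trans (ltry K); apply: sphere_integral_le => // x xS.
  by rewrite T1_le// andbT (le_trans (ltW c0))// T1_ge.
- by move=> x xS; rewrite (le_trans (ltW c0))// T1_ge.
- by apply: sphere_integral_ge => //; exact: ltW.
Qed.

Lemma eigenmeasure_truncated_bound (a : R) (h : 'M[R]_d -> R) :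
  0 < a -> measurable_fun (E : set (borel 'M[R]_d)) h ->
  (forall g, E g -> 0 <= h g) ->
  (\int[mu]_(g in E) (h g)%:E < +oo)%E ->
  (forall g f x n, E g -> sphere_nneg f -> sphere_nneg x ->
    enorm (g *m x) `^ s * truncated_potential a n f (proj_act g x) <= h g) ->
  exists M : R, forall f n, sphere_nneg f ->
    (\int[nu]_(x in sphere_nneg) (truncated_potential a n f x)%:E <= M%:E)%E.
Proof.
move=> a0 mh h0 hoo hb; have [nuS eig] := nu_eigen.
pose K := fine (\int[mu]_(g in E) (h g)%:E)%E.
have KE : (K%:E = \int[mu]_(g in E) (h g)%:E)%E.
  by rewrite fineK// ge0_fin_numE// integral_ge0// => g Eg; rewrite lee_fin h0.
exists (K / kappa) => f n fS; set phi := truncated_potential a n f.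
have T0 x : 0 <= transfer mu s phi x.
  by apply: Rintegral_ge0 => g _; rewrite mulr_ge0 ?powR_ge0.
have TK x : sphere_nneg x -> transfer mu s phi x <= K.
  move=> xS; apply: Rintegral_le_ereal; last by move=> g _; rewrite mulr_ge0 ?powR_ge0.
  rewrite KE; apply: integral_le_on_full => //.
  - exact/measurable_EFinP.
  - by move=> g _; rewrite lee_fin mulr_ge0 ?powR_ge0.
  - by move=> g _ Eg; rewrite lee_fin hb.
have cphi : {within sphere_nneg, continuous phi}.
  by apply: continuous_subspaceT; exact: truncated_potential_continuous.
have : kappa * \int[nu]_(x in sphere_nneg) phi x <= K.
  rewrite -eig//; apply: Rintegral_le_ereal => //.
  by apply: sphere_integral_le => // x xS; rewrite T0 TK.
rewrite -ler_pdivlMl ?kappa_gt0// mulrC => phiK.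
rewrite -lee_fin in phiK; apply: le_trans phiK; apply: Rintegral_ge_ereal => //.
  apply: le_lt_trans (ltry ((n.+1%:R^-1) `^ (- a))); apply: sphere_integral_le => // x _.
  rewrite truncated_potential_ge0/=; apply: truncated_potential_le; first exact: ltW.
    by rewrite invr_gt0 ltr0n.
  by rewrite le_max lexx.
by move=> x _; exact: truncated_potential_ge0.
Qed.

End eigenmeasure_bound.

(** * Transfer to the stationary measure *)

Section stationary_measure_bound.
Context {R : realType} {d : nat}.
Variables (nu pi_s : probability (borel 'cV[R]_d) R) (r : 'cV[R]_d -> R).
Hypothesis d_gt0 : (0 < d)%N.
Hypothesis nu_sphere : nu sphere_nneg = 1%E.
Hypothesis r_cont : {within sphere_nneg, continuous r}.
Hypothesis r_gt0 : forall x, sphere_nneg x -> 0 < r x.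
Hypothesis pi_nu : is_pi nu r pi_s.

(** The continuous functions r and 1 / r are bounded on the compact sphere, so
    pi_s(phi) is at most (max r / min r) nu(phi). *)
Lemma pi_truncated_bound (a M : R) : 0 < a ->
  (forall f n, sphere_nneg f ->
    (\int[nu]_(x in sphere_nneg) (truncated_potential a n f x)%:E <= M%:E)%E) ->
  exists M' : R, forall f n, sphere_nneg f ->
    (\int[pi_s]_(x in sphere_nneg) (truncated_potential a n f x)%:E <= M'%:E)%E.
Proof.
move=> a0 HM; have [piS piE] := pi_nu.
have S0 : (sphere_nneg : set 'cV[R]_d) !=set0.
  by exists (basis_vec (Ordinal d_gt0)); exact: basis_vec_sphere.
have [xM /set_mem xMS rM] := compact_EVT_max S0 sphere_compact r_cont.
have [xm /set_mem xmS rm] := compact_EVT_min S0 sphere_compact r_cont.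
have {rM} rM x : sphere_nneg x -> r x <= r xM by move=> xS; apply: rM; exact: mem_set.
have {rm} rm x : sphere_nneg x -> r xm <= r x by move=> xS; apply: rm; exact: mem_set.
have [rM0 rm0] := (r_gt0 xMS, r_gt0 xmS).
exists (r xM * M / r xm) => f n fS; set phi := truncated_potential a n f.
have phi0 x : 0 <= phi x by exact: truncated_potential_ge0.
have cphi : {within sphere_nneg, continuous phi}.
  by apply: continuous_subspaceT; exact: truncated_potential_continuous.
have num_le : \int[nu]_(x in sphere_nneg) (phi x * r x) <= r xM * M.
  apply: Rintegral_le_ereal; last by move=> x xS; rewrite mulr_ge0// ltW// r_gt0.
  apply: (@le_trans _ _ (\int[nu]_(x in sphere_nneg) ((r xM)%:E * (phi x)%:E))%E).
    apply: ge0_le_integral_sub => // x xS; rewrite -?EFinM lee_fin.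
    - by rewrite mulr_ge0// ltW// r_gt0.
    - by rewrite mulr_ge0// ltW.
    - by rewrite mulrC ler_wpM2r// rM.
  rewrite ge0_integralZl//.
  - by rewrite EFinM lee_wpmul2l ?HM// lee_fin ltW.
  - exact: sphere_measurable.
  - by apply/measurable_EFinP; exact: truncated_potential_measurable.
  - by move=> x _; rewrite lee_fin.
  - by rewrite lee_fin ltW.
have den_ge : r xm <= \int[nu]_(x in sphere_nneg) r x.
  rewrite -lee_fin; apply: Rintegral_ge_ereal.
  - apply: le_lt_trans (ltry (r xM)); apply: sphere_integral_le => // x xS.
    by rewrite rM// andbT ltW// r_gt0.
  - by move=> x xS; rewrite ltW// r_gt0.
  - by apply: sphere_integral_ge => //; exact: ltW.
have M0 : 0 <= M.
  by rewrite -lee_fin; apply: le_trans (HM f n fS); apply: integral_ge0 => x _; rewrite lee_fin.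
have phi_le : \int[pi_s]_(x in sphere_nneg) phi x <= r xM * M / r xm.
  rewrite piE//; have I0 := lt_le_trans rm0 den_ge.
  apply: (@le_trans _ _ (r xM * M / \int[nu]_(x in sphere_nneg) r x)).
    by rewrite ler_wpM2r ?invr_ge0 ?(ltW I0)//; exact: num_le.
  by rewrite ler_wpM2l ?mulr_ge0 ?(ltW rM0)// lef_pV2 ?posrE.
rewrite -lee_fin in phi_le; apply: le_trans phi_le; apply: Rintegral_ge_ereal => //.
apply: le_lt_trans (ltry ((n.+1%:R^-1) `^ (- a))); apply: sphere_integral_le => // x _.
rewrite phi0/=; apply: truncated_potential_le; first exact: ltW.
  by rewrite invr_gt0 ltr0n.
by rewrite le_max lexx.
Qed.

End stationary_measure_bound.

(** * Domination of the transfer operator *)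

Section domination.
Context {R : realType} {d : nat}.
Variable mu : probability (borel 'M[R]_d) R.
Hypothesis mu_nneg : mu mx_nneg = 1%E.
Hypothesis d_gt0 : (0 < d)%N.

(** What the two alternative sets of conditions have in common: a bound, by one
    integrable function of g, of all the functions integrated to obtain the values
    of P_s on truncated potentials. The set E discards null sets: for g in E the
    vector g x never vanishes, and E lies in the domain of integration of P_s. *)
Definition dominated (s : R) : Prop :=
  exists (a : R) (E : set 'M[R]_d) (h : 'M[R]_d -> R),
  [/\ 0 < a,
      [/\ measurable (E : set (borel 'M[R]_d)), mu E = 1%E, E `<=` supp mu &
          forall g, E g -> forall i j, 0 < g i j],
      [/\ measurable_fun (E : set (borel 'M[R]_d)) h, forall g, E g -> 0 <= h g &
          (\int[mu]_(g in E) (h g)%:E < +oo)%E] &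
      forall g f x n, E g -> sphere_nneg f -> sphere_nneg x ->
        enorm (g *m x) `^ s * truncated_potential a n f (proj_act g x) <= h g].

Lemma measurable_supp : measurable (supp mu : set (borel 'M[R]_d)).
Proof. by apply: closed_measurable_borel; exact: supp_closed. Qed.

Lemma supp_mx_full : mu (supp mu) = 1%E.
Proof. by apply: supp_full; exact: mx_second_countable. Qed.

Lemma column_comparable_entries : column_comparable mu ->
  exists2 C : R, 0 < C & forall g, supp mu g ->
    (forall i j, 0 < g i j) /\ (forall i k j, g i j <= C * g k j).
Proof.
move=> /choice[C CP]; exists (\sum_j C j).
  rewrite (bigD1 (Ordinal d_gt0))//= ltr_pwDl//.
    by have [/(lt_trans ltr01)] := CP (Ordinal d_gt0).
  by apply: sumr_ge0 => j _; have [/(lt_trans ltr01)/ltW] := CP j.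
move=> g sg; have g0 := supp_nneg mu_nneg sg.
have key i k j : 0 < g k j /\ g i j <= C j * g k j.
  have [C1 /(_ g sg)/andP[le1 leC]] := CP j.
  have m0 : 0 <= col_min g j by apply/bigmin_geP; split=> // i' _; exact: g0.
  have mk : col_min g j <= g k j by exact: (bigmin_le _ k (fun i => g i j)).
  have Mi : g i j <= col_max g j by exact: (le_bigmax _ (fun i => g i j)).
  have m_gt0 : 0 < col_min g j.
    rewrite lt_neqAle m0 andbT eq_sym; apply/eqP => m00.
    by move: le1; rewrite m00 invr0 mulr0 ler10.
  split; first exact: lt_le_trans mk.
  apply: (le_trans Mi); move: leC; rewrite ler_pdivrMr// => /le_trans; apply.
  by rewrite ler_wpM2l// ltW// (lt_trans ltr01).
split=> [i j|i k j]; first by have [] := key i i j.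
have [gk /le_trans] := key i k j; apply; rewrite ler_wpM2r ?(ltW gk)//.
rewrite (bigD1 j)//= lerDl; apply: sumr_ge0 => l _.
by have [/(lt_trans ltr01)/ltW] := CP l.
Qed.

(** The columns of g have comparable entries, hence so has g x, which is a
    non-negative combination of the columns. Each coordinate of g x is thus at
    least |g x| / (d C), and so is <f, g x>. *)
Lemma column_comparable_dominated (s : R) : 0 <= s -> column_comparable mu ->
  (\int[mu]_(g in mx_nneg) (entry_sum g `^ s)%:E < +oo)%E -> dominated s.
Proof.
move=> s0 /column_comparable_entries[C C0 CP] moment_s.
pose D : R := d%:R * C; have D0 : 0 < D by rewrite mulr_gt0 ?ltr0n.
exists 1, (supp mu), (fun g => D * entry_sum g `^ s).
have msupp := measurable_supp.
have mS : measurable_fun (supp mu : set (borel 'M[R]_d)) (fun g => entry_sum g `^ s).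
  exact: measurable_entry_sum_powR.
split=> //.
- by split=> //; [exact: supp_mx_full|move=> g /CP[]].
- split=> [|g _|]; [|by rewrite mulr_ge0 ?powR_ge0// ltW|].
    by apply: measurable_funM => //; exact: measurable_cst.
  under eq_integral do rewrite EFinM.
  rewrite ge0_integralZl//; last 3 first.
  + exact/measurable_EFinP.
  + by move=> g _; rewrite lee_fin powR_ge0.
  + by rewrite lee_fin ltW.
  apply: lte_mul_pinfty; rewrite ?lee_fin ?(ltW D0)//.
  apply: le_lt_trans moment_s; apply: ge0_le_integral_sub => //.
  + exact: supp_nneg.
  + by move=> g _; rewrite lee_fin powR_ge0.
  + by move=> g _; rewrite lee_fin powR_ge0.
move=> g f x n sg fS xS; have [gpos gC] := CP g sg.
have g0 := supp_nneg mu_nneg sg; have gx0 := mulmx_nneg g0 xS.1.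
have gxC i k : (g *m x) i 0 <= C * (g *m x) k 0.
  rewrite !mxE mulr_sumr; apply: ler_sum => j _; rewrite mulrA.
  by rewrite ler_wpM2r//; exact: xS.1.
set e := enorm (g *m x).
have eD k : e <= D * (g *m x) k 0.
  apply: (le_trans (enorm_le_sum gx0)).
  apply: (@le_trans _ _ (\sum_(i < d) C * (g *m x) k 0)); first exact: ler_sum.
  by rewrite sumr_const card_ord -mulr_natl mulrA.
(* Some x j is positive, and then every coordinate of g x is. *)
have e0 : 0 < e.
  have [j xj] := sphere_index xS; pose i0 := Ordinal d_gt0.
  suff : 0 < (g *m x) i0 0.
    by move=> /lt_le_trans; apply; exact: (@enorm_ge_entry _ _ _ _ i0).
  rewrite mxE (bigD1 j)//= ltr_pwDl ?mulr_gt0//.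
  by apply: sumr_ge0 => k _; rewrite mulr_ge0//; exact: xS.1.
have l0 : 0 < e / D by rewrite divr_gt0.
apply: (le_trans (truncated_potential_proj_act_le n ler01 s0 l0 e0 _)).
  by apply: dotv_sphere_ge => // [|k]; [exact: ltW|rewrite ler_pdivrMr// mulrC].
rewrite -/e powRD ?(gt_eqF e0) ?implybT// !powRr1 ?invr_ge0 ?(ltW e0) ?(ltW l0)//.
rewrite invf_div -mulrA [e * _]mulrC divfK ?gt_eqF// mulrC ler_wpM2l ?(ltW D0)//.
by rewrite ge0_ler_powR ?nnegrE ?(ltW e0) ?entry_sum_ge0// enorm_le_entry_sum.
Qed.

(** An entry vanishing with positive probability would have infinite harmonic
    moments. *)
Lemma harmonic_entries_pos : harmonic_moments mu ->
  exists2 E : set 'M[R]_d, measurable (E : set (borel 'M[R]_d)) /\ mu E = 1%E &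
    E `<=` supp mu /\ forall g, E g -> forall i j, 0 < g i j.
Proof.
move=> H; pose Z (p : 'I_d * 'I_d) := mx_nneg `&` [set g : 'M[R]_d | g p.1 p.2 = 0].
have mZ p : measurable (Z p : set (borel 'M[R]_d)).
  apply: closed_measurable_borel; apply: closedI; first exact: mx_nneg_closed.
  apply: (@preimage_closed _ _ (fun g : 'M[R]_d => g p.1 p.2) [set 0]).
    by move=> g _; exact: coord_continuous.
  exact: closed_eq.
have Z0 p : mu (Z p) = 0%E.
  have [e [e0]] := H p.1 p.2; apply: integral_lty_null => //.
  - by move=> g [].
  - by move=> g _; rewrite inve_ge0 lee_fin powR_ge0.
  - by move=> g [_ /= ->]; rewrite powR0 ?gt_eqF// inve0.
pose U : set 'M[R]_d := \big[setU/set0]_p Z p.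
have mU : measurable (U : set (borel 'M[R]_d)) by apply: bigsetU_measurable.
have mE : measurable (supp mu `\` U : set (borel 'M[R]_d)).
  by apply: measurableD => //; exact: measurable_supp.
exists (supp mu `\` U).
  split=> //; apply: full_of_negligible => //.
  rewrite setCD; apply: negligibleU.
    by apply: negligible_setC_full; [exact: measurable_supp|exact: supp_mx_full].
  rewrite /U; elim/big_ind : _ => [|A B|p _]; first exact: negligible_set0.
    exact: negligibleU.
  by apply/negligibleP; [exact: mZ|exact: Z0].
split=> [g []//|g [sg nU] i j]; have g0 := supp_nneg mu_nneg sg.
rewrite lt_neqAle g0 andbT; apply/eqP => gij; apply: nU.
by rewrite /U (bigD1 (i, j))//=; left; split=> //=.
Qed.

(** Both |g x| and <f, g x> are at least the smallest entry of g, which is at least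
    a negative power of [recip_sum], itself integrable; [powR_balance] then trades
    this power against the moment of order p > s. *)
Lemma harmonic_dominated (s p : R) : 0 <= s -> s < p -> harmonic_moments mu ->
  (\int[mu]_(g in mx_nneg) (entry_sum g `^ p)%:E < +oo)%E -> dominated s.
Proof.
move=> s0 sp H moment_p; have [E [mE muE] [Es Epos]] := harmonic_entries_pos H.
have [e eP] : exists e : 'I_d -> 'I_d -> R, forall i j, 0 < e i j /\
    (\int[mu]_(g in mx_nneg) ((g i j `^ e i j)%:E)^-1 < +oo)%E.
  have /choice[e eP] i : exists ei : 'I_d -> R, forall j, 0 < ei j /\
    (\int[mu]_(g in mx_nneg) ((g i j `^ ei j)%:E)^-1 < +oo)%E.
    by have /choice[ei eiP] := H i; exists ei.
  by exists e.
(* Any common upper bound of the 1 / e i j would do. *)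
pose q := 1 + \sum_i \sum_j (e i j)^-1.
have e0 i j : 0 <= (e i j)^-1 by rewrite invr_ge0 ltW//; have [] := eP i j.
have q0 : 0 < q by rewrite ltr_pwDl//; do 2 apply: sumr_ge0 => ? _.
have eq i j : (e i j)^-1 <= q.
  rewrite /q (bigD1 i)//= (bigD1 j)//=.
  have X0 : 0 <= \sum_(k < d | k != j) (e i k)^-1 by apply: sumr_ge0.
  have Y0 : 0 <= \sum_(k < d | k != i) \sum_(l < d) (e k l)^-1.
    by do 2 apply: sumr_ge0 => ? _.
  lra.
have [a a0 aP] := powR_balance s0 sp q0.
exists a, E, (fun g => 1 + entry_sum g `^ p + recip_sum e g).
have mS : measurable_fun (E : set (borel 'M[R]_d)) (fun g => entry_sum g `^ p).
  exact: measurable_entry_sum_powR.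
have mB := measurable_recip_sum e mE.
have B1 := recip_sum_ge1 e.
have B0 g : 0 <= recip_sum e g := le_trans ler01 (B1 g).
have m1 : measurable_fun (E : set (borel 'M[R]_d)) (fun g => 1 + entry_sum g `^ p).
  by apply: measurable_funD => //; exact: measurable_cst.
have Eint1 : (\int[mu]_(g in E) 1 = 1)%E.
  by rewrite (integral_cst mu mE 1%E) mul1e.
split=> //.
- split=> [|g _|]; first exact: measurable_funD.
    by rewrite addr_ge0// addr_ge0// powR_ge0.
  under eq_integral do rewrite EFinD.
  rewrite ge0_integralD//; last 4 first.
  + by move=> g _; rewrite lee_fin addr_ge0 ?powR_ge0.
  + exact/measurable_EFinP.
  + by move=> g _; rewrite lee_fin.
  + exact/measurable_EFinP.
  apply: lte_add_pinfty.
    under eq_integral do rewrite EFinD.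
    rewrite ge0_integralD//; last 2 first.
    + by move=> g _; rewrite lee_fin powR_ge0.
    + exact/measurable_EFinP.
    rewrite Eint1; apply: lte_add_pinfty => //; first exact: ltry.
    apply: le_lt_trans moment_p; apply: ge0_le_integral_sub => //.
    + by move=> g /Es; exact: supp_nneg.
    + by move=> g _; rewrite lee_fin powR_ge0.
    + by move=> g _; rewrite lee_fin powR_ge0.
  under eq_integral do rewrite /recip_sum EFinD -sumEFin.
  rewrite ge0_integralD//; last 2 first.
  + by move=> g _; apply: sume_ge0 => i _; rewrite lee_fin sumr_ge0// => j _; exact: powR_ge0.
  + apply: emeasurable_sum => i; apply/measurable_EFinP.
    by apply: measurable_sum => j; exact: measurable_entry_powR.
  rewrite Eint1; apply: lte_add_pinfty => //; first exact: ltry.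
  rewrite ge0_integral_sum//; last 2 first.
  + move=> i; apply/measurable_EFinP.
    by apply: measurable_sum => j; exact: measurable_entry_powR.
  + by move=> i g _; rewrite lee_fin sumr_ge0// => j _; exact: powR_ge0.
  apply: lte_sum_pinfty => i _.
  under eq_integral do rewrite -sumEFin.
  rewrite ge0_integral_sum//; last 2 first.
  + by move=> j; apply/measurable_EFinP; exact: measurable_entry_powR.
  + by move=> j g _; rewrite lee_fin powR_ge0.
  apply: lte_sum_pinfty => j _.
  have [eij0] := eP i j; apply: le_lt_trans; apply: ge0_le_integral_sub.
  + by move=> g /Es; exact: supp_nneg.
  + by move=> g _; rewrite lee_fin powR_ge0.
  + by move=> g _; rewrite inve_ge0 lee_fin powR_ge0.
  + by move=> g Eg; rewrite inver gt_eqF ?powR_gt0 ?Epos// powRN.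
move=> g f x n Eg fS xS; have g0 := supp_nneg mu_nneg (Es _ Eg).
pose l := (recip_sum e g `^ q)^-1.
have l0 : 0 < l by rewrite invr_gt0 powR_gt0// (lt_le_trans ltr01).
have lg i j : l <= g i j.
  by apply: recip_sum_entry; [exact: Epos|have [] := eP i j|exact: eq].
have lgx := mulmx_entry_ge xS (ltW l0) lg.
have egx : 0 < enorm (g *m x).
  by apply: (lt_le_trans l0); apply: (@enorm_ge_entry _ _ _ _ (Ordinal d_gt0)).
apply: (le_trans (truncated_potential_proj_act_le n (ltW a0) s0 l0 egx _)).
  by apply: dotv_sphere_ge => //; exact: ltW.
rewrite invrK; apply: le_trans (aP _ _ (entry_sum_ge0 g0) (B1 g)).
rewrite ler_wpM2r ?powR_ge0// ge0_ler_powR ?nnegrE ?enorm_ge0 ?entry_sum_ge0//.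
  by rewrite addr_ge0// ltW.
exact: enorm_le_entry_sum.
Qed.

Lemma moment_cond_entry_sum : moment_cond mu ->
  exists2 p : R, 0 < p & (\int[mu]_(g in mx_nneg) (entry_sum g `^ p)%:E < +oo)%E.
Proof.
move=> [p [p0 _ H]]; exists p => //; apply: entry_sum_moment => //; first exact: ltW.
apply: le_lt_trans H; apply: ge0_le_integral_sub => //.
- by move=> g _; rewrite lee_fin powR_ge0.
- by move=> g _; exact: poweR_ge0.
move=> g g0; rewrite -poweR_EFin; apply: gt0_ler_poweR; first exact: ltW.
- by rewrite in_itv/= lee_fin opnorm_ge0// leey.
- by rewrite in_itv/= leey andbT /N_mx le_max lee_fin opnorm_ge0.
- by rewrite /N_mx le_max lexx.
Qed.

Lemma I_mu_entry_sum (s : R) : I_mu mu s ->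
  (\int[mu]_(g in mx_nneg) (entry_sum g `^ s)%:E < +oo)%E.
Proof. by move=> [s0 H]; exact: entry_sum_moment. Qed.

Lemma I_mu_interior (s : R) : (I_mu mu)° s -> exists2 p, s < p & I_mu mu p.
Proof.
move=> /nbhs_ballP[e /= e0 He]; exists (s + e / 2); first by rewrite ltrDl divr_gt0.
apply: He; rewrite /ball/= opprD addrA subrr add0r normrN gtr0_norm ?divr_gt0//.
by rewrite ltr_pdivrMr// ltr_pMr// ltr1n.
Qed.

End domination.

(** * Regularity of the eigenmeasure and of the stationary measure *)

Theorem proposition3p3 (R : realType) (d : nat) (hd : (2 <= d)%N)
  (mu : probability (borel 'M[R]_d) R) (hmu : mu mx_nneg = 1%E)
  (nu : probability (borel 'cV[R]_d) R) (hnu : is_stationary mu nu)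
  (hcond : column_comparable mu \/
    [/\ moment_cond mu, harmonic_moments mu & non_arithmetic mu nu])
  (s : R) (hs : s = 0 \/ (I_mu mu)° s)
  (kappa : R) (r : 'cV[R]_d -> R) (hr : is_pos_eigenfunction mu s kappa r)
  (nu_s : probability (borel 'cV[R]_d) R)
  (hnu_s : is_eigenmeasure mu s kappa nu_s) :
  [/\ exists alpha : R, 0 < alpha /\ neg_moment_bound nu_s alpha,
      exists alpha C : R,
        [/\ 0 < alpha, 0 < C & small_ball_bound nu_s alpha C] &
      forall pi_s : probability (borel 'cV[R]_d) R, is_pi nu_s r pi_s ->
        (exists alpha : R, 0 < alpha /\ neg_moment_bound pi_s alpha) /\
        (exists alpha C : R,
          [/\ 0 < alpha, 0 < C & small_ball_bound pi_s alpha C])].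
Proof.
have d0 : (0 < d)%N by exact: ltn_trans hd.
have s0 : 0 <= s by case: hs => [->//|/interior_subset []].
have moment_s : (\int[mu]_(g in mx_nneg) (entry_sum g `^ s)%:E < +oo)%E.
  case: hs => [->|/interior_subset]; last exact: I_mu_entry_sum.
  under eq_integral do rewrite powRr0.
  by rewrite (integral_cst mu measurable_mx_nneg 1%E) mul1e [X in (X < _)%E]hmu ltry.
have [a [E [h [a0 [mE muE Es Epos] [mh h0 hoo] hb]]]] : dominated mu s.
  case: hcond => [cc|[mc hm _]]; first exact: column_comparable_dominated.
  case: hs => [s00|/I_mu_interior[p sp /(I_mu_entry_sum d0) Ip]].
    have [p p0 Ip] := moment_cond_entry_sum d0 mc.
    by apply: (harmonic_dominated hmu d0 s0 _ hm Ip); rewrite s00.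
  exact: (harmonic_dominated hmu d0 s0 sp hm Ip).
have [M HM] := eigenmeasure_truncated_bound hmu s0 mE muE Es Epos moment_s hnu_s a0
  mh h0 hoo hb.
have from_truncations (P : probability (borel 'cV[R]_d) R) (K : R) :
    (forall f n, sphere_nneg f ->
      (\int[P]_(x in sphere_nneg) (truncated_potential a n f x)%:E <= K%:E)%E) ->
    (exists alpha : R, 0 < alpha /\ neg_moment_bound P alpha) /\
    (exists alpha C : R, [/\ 0 < alpha, 0 < C & small_ball_bound P alpha C]).
  move=> /(neg_moment_bound_of_truncations a0) Pa; split; first by exists a.
  by have [C C0 PC] := small_ball_of_neg_moment a0 Pa; exists a, C.
have [nu_neg nu_ball] := from_truncations nu_s M HM.
split=> // pi_s pi_nu; have [r_cont r_gt0 _] := hr.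
have [M' HM'] := pi_truncated_bound d0 hnu_s.1 r_cont r_gt0 pi_nu a0 HM.
exact: from_truncations HM'.
Qed.
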